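(* Let $k$ be an even positive integer, let $1\leq\ell_1\leq\ell_2\leq\ell_3\leq\ell_4$ be integers and $n=\ell_1+\ell_2+\ell_3+\ell_4$. Then the spider graph $S_{\ell_1,\ell_2,\ell_3,\ell_4}$ can be embedded in $K_k^*$ if and only if $k\geq4$, $n\leq\frac{k^2+4}{2}$, and $(k,\ell_1)\neq(4,2)$.
   Context: $K_k^*$ denotes the complete graph $K_k$ on vertices $v_0,\dotsc,v_{k-1}$ with a loop $v_iv_i$ added at every vertex. An embedding of a graph $G$ in $K_k^*$ is a map $f:V(G)\to V(K_k^* )$ such that each edge $uv$ of $G$ is sent to the edge $f(u)f(v)$ of $K_k^*$ (a loop if $f(u)=f(v)$), and the induced map $E(G)\to E(K_k^* )$ is injective. The spider graph $S_{\ell_1,\ell_2,\ell_3,\ell_4}$ is the tree with central vertex $x_0$ and four paths (legs) $x_0x^i_1\dotsb x^i_{\ell_i}$, $i=1,\dotsc,4$, of $\ell_i$ edges each, sharing only $x_0$. *)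

(* Defs.v *)
From HB Require Import structures.
From mathcomp Require Import all_boot.

Set Implicit Arguments.
Unset Strict Implicit.
Unset Printing Implicit Defensive.

(* Finite undirected graphs without multiple edges; loops are allowed. *)
Record graph := Graph {
  vertex : finType;
  adj : rel vertex;
  adj_sym : symmetric adj
}.

(* The edge uv is the set [set u; v]; in particular a loop is a singleton. *)
Definition edges (G : graph) : {set {set vertex G}} :=
  [set [set p.1; p.2] | p : vertex G * vertex G & adj p.1 p.2].

(* The induced map on edges is e |-> f @: e, as f @: [set u; v] is            *)
(* [set f u; f v].                                                            *)
Definition is_embedding (G H : graph) (f : vertex G -> vertex H) : Prop :=
  (forall u v, adj u v -> adj (f u) (f v)) /\
  {in edges G &, injective (fun e : {set vertex G} => f @: e)}.

Definition embeds (G H : graph) : Prop :=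
  exists f : vertex G -> vertex H, is_embedding f.

Definition looped_complete_adj (k : nat) : rel 'I_k := fun _ _ => true.

Lemma looped_complete_adj_sym k : symmetric (@looped_complete_adj k).
Proof. by []. Qed.

(* K_k^*: any two vertices, distinct or equal, are adjacent. *)
Definition looped_complete (k : nat) : graph :=
  Graph (@looped_complete_adj_sym k).

Section Spider.

Variables (m : nat) (l : m.-tuple nat).

(* None is the centre x_0; Some (Tagged _ j) with tag i is x^i_(j+1), for     *)
(* j < tnth l i.                                                              *)
Definition spider_vertex : finType := option {i : 'I_m & 'I_(tnth l i)}.

(* v comes right after u when walking away from the centre along a leg. *)
Definition spider_step (u v : spider_vertex) : bool :=
  match u, v with
  | None, Some (existT i j) => j == 0 :> nat
  | Some (existT i j), Some (existT i' j') => (i == i') && (j' == j.+1 :> nat)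
  | _, None => false
  end.

Definition spider_adj : rel spider_vertex :=
  fun u v => spider_step u v || spider_step v u.

Lemma spider_adj_sym : symmetric spider_adj.
Proof. by move=> u v; rewrite /spider_adj orbC. Qed.

Definition spider : graph := Graph spider_adj_sym.

End Spider.

(* Main.v *)
Require Import Defs.
From mathcomp Require Import all_boot zify.

(* An embedded spider is a system of four edge-disjoint trails of K_k^* with  *)
(* a common starting vertex.                                                  *)
(*   Necessity: at a vertex that is not the image of a leaf the trails use an *)
(* even number of the k - 1 non-loop edges, so they miss one of them as k is  *)
(* even; all but four vertices have this property, hence at least (k - 4) / 2 *)
(* edges are missed. For k = 4 and l1 >= 2, the four first edges are all the  *)
(* edges at the centre; one is its loop, whose leg then has no second edge.   *)
(* For k = 2 there are only three edges.                                      *)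
(*   Sufficiency: legs can be truncated, so n = (k^2 + 4) / 2 may be assumed. *)
(* Then the ends of the legs are distinct, and we go from k to k + 2 by       *)
(* appending closed trails to the legs. The new vertices p and q bring the    *)
(* edges of K_{2,k} (and two loops; pq stays unused), and K_{2,S} with |S|    *)
(* even is a closed trail through any vertex of S. Splitting the k old        *)
(* vertices into two even parts, we can lengthen two legs by 4t + 2 and 4s    *)
(* where t + s = k / 2 and t > 0. For k >= 6 this reaches all lengths, so     *)
(* that only k = 4 and k = 6 have to be settled by explicit trails.           *)

Set Implicit Arguments.
Unset Strict Implicit.
Unset Printing Implicit Defensive.

(** Necessity is a degree count on the image. [edges_leq_degrees] bounds twice the number of edges
    by the sum of the non-loop degrees plus [2k]. By [odd_degree], a degree is even away from the
    four leaf images, hence at most [k - 2]. This gives [2n <= k(k-2) + 4 + 2k = k^2 + 4] in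
    [spider_size]; [spider_k_gt2] and [spider_k4] exclude the small exceptions.

    Sufficiency works with lists of trails ([walk_system]), and [realizable_embeds] turns them into
    embeddings, truncating legs on the way. With [k = 2m] the maximal size is [2m^2 + 2]. It grows
    by [4m + 2 = 2k + 2] from [k] to [k + 2]: the [2k] edges from the old vertices to the new ones,
    and two new loops. [realizable_step] attaches them, [step_lengths] finds lengths that allow
    this, and [realizable_maximal] is the induction starting from [realizable6]; [realizable4] is a
    separate case.

    Undirected edges are sorted pairs, so that [uniq] expresses edge-disjointness and can be
    computed. *)

Definition edge (x y : nat) : nat * nat := (minn x y, maxn x y).

Definition walk_edges (v : nat) (w : seq nat) : seq (nat * nat) :=
  pairmap edge v w.

(** Distinct ends are part of the invariant: they let two legs be extended at once by closed trails
    through disjoint sets of old vertices. *)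
Definition walk_system (k v : nat) (ws : seq (seq nat)) : bool :=
  [&& v < k, all (all (fun x => x < k)) ws, uniq (map (last v) ws)
    & uniq (flatten (map (walk_edges v) ws))].

Definition realizable (k : nat) (ls : seq nat) : Prop :=
  exists v ws, map size ws = ls /\ walk_system k v ws.

Lemma edgeC x y : edge x y = edge y x.
Proof. by rewrite /edge minnC maxnC. Qed.

Lemma edge_leq x y : x <= y -> edge x y = (x, y).
Proof. by move=> le_xy; rewrite /edge (minn_idPl le_xy) (maxn_idPr le_xy). Qed.

Lemma edge_ltn x y : x < y -> edge x y = (x, y).
Proof. by move/ltnW/edge_leq. Qed.

Lemma walk_edges_cat v w1 w2 :
  walk_edges v (w1 ++ w2) = walk_edges v w1 ++ walk_edges (last v w1) w2.
Proof. exact: pairmap_cat. Qed.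

Lemma walk_edges_lt k v w :
  v < k -> all (fun x => x < k) w -> all (fun e => e.2 < k) (walk_edges v w).
Proof.
elim: w v => //= x w IH v v_lt /andP[x_lt w_lt].
by rewrite gtn_max v_lt x_lt IH.
Qed.

Lemma walk_system_perm k v ws ws' :
  perm_eq ws ws' -> walk_system k v ws = walk_system k v ws'.
Proof.
move=> eq_ws; rewrite /walk_system (perm_all _ eq_ws).
rewrite (perm_uniq (perm_map (last v) eq_ws)).
by rewrite (perm_uniq (perm_flatten (perm_map (walk_edges v) eq_ws))).
Qed.

Lemma walk_system_swap k v w1 w2 ws :
  walk_system k v [:: w1, w2 & ws] = walk_system k v [:: w2, w1 & ws].
Proof.
by apply: walk_system_perm; apply/permPl; apply: (perm_catCA [:: _] [:: _]).
Qed.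

Lemma realizable_perm k ls ls' :
  perm_eq ls ls' -> realizable k ls -> realizable k ls'.
Proof.
rewrite perm_sym => /(perm_iotaP 0)[I I_perm ->] [v [ws [eq_ls ws_sys]]].
move: I_perm; rewrite -eq_ls size_map => I_perm.
have ws_perm : perm_eq [seq nth [::] ws i | i <- I] ws.
  apply: (perm_trans (perm_map _ I_perm)).
  by rewrite -/(mkseq _ _) mkseq_nth.
exists v, [seq nth [::] ws i | i <- I]; rewrite (walk_system_perm _ _ ws_perm).
split=> //; rewrite -map_comp; apply/eq_in_map=> i /=.
rewrite (perm_mem I_perm) mem_iota => /= lt_i; by rewrite (nth_map [::]).
Qed.

Lemma walk_system_leq k k' v ws :
  k <= k' -> walk_system k v ws -> walk_system k' v ws.
Proof.
move=> le_k /and4P[v_lt ws_lt u_ends u_edges].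
apply/and4P; split=> //; first exact: leq_trans le_k.
by apply: sub_all ws_lt => w; apply: sub_all => x /leq_trans; apply.
Qed.

Lemma walk_system_extend k v w ws D :
    all (fun x => x < k) D -> last (last v w) D = last v w ->
    uniq (walk_edges (last v w) D ++ flatten (map (walk_edges v) (w :: ws))) ->
  walk_system k v (w :: ws) -> walk_system k v ((w ++ D) :: ws).
Proof.
move=> D_lt D_closed uD /and4P[v_lt /= /andP[w_lt ws_lt] uw _].
rewrite /walk_system v_lt /= all_cat w_lt D_lt ws_lt last_cat D_closed uw /=.
by rewrite walk_edges_cat -catA uniq_catCA.
Qed.

(** * Closed trails through two new vertices *)

Definition spokes (p q : nat) (s : seq nat) : seq (nat * nat) :=
  [seq (x, y) | x <- s, y <- [:: p; q]].

Lemma spokes_cat p q s1 s2 :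
  spokes p q (s1 ++ s2) = spokes p q s1 ++ spokes p q s2.
Proof. by rewrite /spokes map_cat flatten_cat. Qed.

(* From p, the edges of K_{2,s} between s and {p, q}, traversed as p c q d p. *)
Fixpoint zigzag (p q : nat) (s : seq nat) : seq nat :=
  if s is c :: d :: s' then [:: c, q, d, p & zigzag p q s'] else [::].

(* The closed trail K_{2,S} at a, where S is a :: b :: s and s has even size, *)
(* together with the loops at p and q if e holds.                             *)
Definition detour (p q : nat) (e : bool) (a b : nat) (s : seq nat) : seq nat :=
  p :: nseq e p ++ zigzag p q s ++ b :: q :: nseq e q ++ [:: a].

Arguments detour : simpl never.

Lemma even_seq_ind (T : Type) (P : seq T -> Prop) :
    P [::] -> (forall c d s, ~~ odd (size s) -> P s -> P [:: c, d & s]) ->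
  forall s, ~~ odd (size s) -> P s.
Proof.
move=> P0 PS s; have [n] := ubnP (size s); elim: n s => // n IH [|c [|d s]] //=.
rewrite negbK => lt_n s_even; apply: PS => //; apply: IH => //; lia.
Qed.

Lemma size_zigzag p q s : ~~ odd (size s) -> size (zigzag p q s) = (size s).*2.
Proof.
elim/even_seq_ind: s / => //= c d s _ ->; lia.
Qed.

Lemma size_detour p q e a b s : ~~ odd (size s) ->
  size (detour p q e a b s) = (size s).*2 + e.*2 + 4.
Proof.
move=> s_even; rewrite /detour /= size_cat size_nseq size_cat size_zigzag //=.
by rewrite size_cat size_nseq /=; lia.
Qed.

Lemma last_zigzag p q s : last p (zigzag p q s) = p.
Proof.
have [n] := ubnP (size s); elim: n s => // n IH [|c [|d s]] //= lt_n.
by apply: IH; lia.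
Qed.

Lemma last_detour p q e a b s x : last x (detour p q e a b s) = a.
Proof. by rewrite /detour /= !last_cat /= last_cat. Qed.

Lemma all_zigzag (P : pred nat) p q s : P p -> P q -> all P s ->
  all P (zigzag p q s).
Proof.
move=> Pp Pq; have [n] := ubnP (size s).
elim: n s => // n IH [|c [|d s]] //= lt_n.
by case/and3P=> -> -> /IH ->; rewrite ?Pp ?Pq //; lia.
Qed.

Lemma all_detour (P : pred nat) p q e a b s : P p -> P q -> P a -> P b ->
  all P s -> all P (detour p q e a b s).
Proof.
move=> Pp Pq Pa Pb Ps.
rewrite /detour /= !(all_cat, all_nseq) /= !(all_cat, all_nseq) /=.
by rewrite Pp Pq Pa Pb all_zigzag // !orbT.
Qed.

Lemma zigzag_edges p q s : all (fun x => (x < p) && (x < q)) s ->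
  ~~ odd (size s) -> perm_eq (walk_edges p (zigzag p q s)) (spokes p q s).
Proof.
move=> + s_even; elim/even_seq_ind: s / s_even => //= c d s _ IH.
case/and3P=> /andP[cp cq] /andP[dp dq] /IH/permP{}IH.
rewrite (edgeC p) (edgeC q) !edge_ltn //; apply/permP=> P.
by move: (IH P); rewrite /spokes /= => ->; lia.
Qed.

Lemma detour_edges p q e a b s :
    all (fun x => (x < p) && (x < q)) [:: a, b & s] -> ~~ odd (size s) ->
  perm_eq (walk_edges a (detour p q e a b s))
    (spokes p q [:: a, b & s] ++ nseq e (p, p) ++ nseq e (q, q)).
Proof.
case/and3P=> /andP[ap aq] /andP[bp bq] s_lt s_even.
have loopE x : walk_edges x (nseq e x) = nseq e (x, x).
  by case: e; rewrite //= edge_leq.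
have loop_last x : last x (nseq e x) = x by case: (e).
rewrite /detour -cat1s -[b :: _]cat1s -[q :: _]cat1s !walk_edges_cat /=.
rewrite !loop_last last_zigzag !loopE (edgeC p) (edgeC q) !edge_ltn //.
apply/permP=> P; have /permP/(_ P) := zigzag_edges s_lt s_even.
by rewrite /spokes /= !count_cat /= !count_cat /= => ->; lia.
Qed.

Lemma uniq_spokes_cat k s F : uniq s -> all (fun x => x < k) s ->
    all (fun e => e.2 < k) F -> uniq F ->
  uniq ((spokes k k.+1 s ++ [:: (k, k); (k.+1, k.+1)]) ++ F).
Proof.
move=> us s_lt F_lt uF; rewrite cat_uniq uF andbT; apply/andP; split.
  rewrite cat_uniq allpairs_uniq ?us //=; last 2 first.
  - by rewrite inE; lia.
  - by move=> [x y] [x' y'].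
  rewrite !inE !xpair_eqE; apply/andP; split; last lia.
  apply/norP; split; last rewrite orbF; apply/allpairsP => -[[x y] /=] [];
    move=> /(allP s_lt) + _ [] ; lia.
apply/hasPn => -[x y] /(allP F_lt) /= y_lt.
rewrite mem_cat !inE !xpair_eqE negb_or; apply/andP; split; last lia.
apply/allpairsP => -[[x' y'] /=] [_ + []]; rewrite !inE; lia.
Qed.

(** The vertices [k] and [k.+1] are new, and old edges have maximum below [k], so spokes and new
    loops cannot repeat them. *)
Lemma walk_system_spokes k v ws V : perm_eq V (iota 0 k) ->
    walk_system k v ws ->
  [/\ all (fun x => (x < k) && (x < k.+1)) V, all (fun x => x < k.+2) V
    & uniq ((spokes k k.+1 V ++ [:: (k, k); (k.+1, k.+1)]) ++
            flatten (map (walk_edges v) ws))].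
Proof.
move=> V_perm /and4P[v_lt ws_lt _ uF].
have V_lt : all (fun x => x < k) V.
  by rewrite (perm_all _ V_perm); apply/allP=> x; rewrite mem_iota.
split; try by apply: sub_all V_lt => x /= x_lt; rewrite ?x_lt ?leqW.
apply: uniq_spokes_cat => //; first by rewrite (perm_uniq V_perm) iota_uniq.
elim: ws ws_lt {uF} => //= w ws IH /andP[w_lt /IH].
by rewrite all_cat (walk_edges_lt v_lt w_lt).
Qed.

Lemma walk_system_detour k v w ws b s : ~~ odd (size s) ->
    perm_eq [:: last v w, b & s] (iota 0 k) -> walk_system k v (w :: ws) ->
  walk_system k.+2 v ((w ++ detour k k.+1 true (last v w) b s) :: ws).
Proof.
move=> s_even V_perm ws_sys.
have [V_lt V_lt2 uV] := walk_system_spokes V_perm ws_sys.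
move: V_lt2 => /and3P[a_lt b_lt s_lt].
apply: walk_system_extend; rewrite ?last_detour //.
- by apply: all_detour => //; apply: ltnW.
- by rewrite (perm_uniq (perm_cat (detour_edges _ V_lt s_even) (perm_refl _))).
- by apply: walk_system_leq ws_sys; rewrite leqW.
Qed.

Lemma walk_system_detour2 k v w1 w2 ws b1 s1 b2 s2 :
    ~~ odd (size s1) -> ~~ odd (size s2) ->
    perm_eq ([:: last v w1, b1 & s1] ++ [:: last v w2, b2 & s2]) (iota 0 k) ->
    walk_system k v [:: w1, w2 & ws] ->
  walk_system k.+2 v [:: w1 ++ detour k k.+1 true (last v w1) b1 s1,
                         w2 ++ detour k k.+1 false (last v w2) b2 s2 & ws].
Proof.
move=> s1_even s2_even V_perm ws_sys.
have [+ + uV] := walk_system_spokes V_perm ws_sys.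
rewrite !all_cat => /andP[V1_lt V2_lt].
case/andP=> /and3P[a1_lt b1_lt s1_lt] /and3P[a2_lt b2_lt s2_lt].
have D1 := detour_edges true V1_lt s1_even.
have D2 := detour_edges false V2_lt s2_even.
set D1w := detour _ _ true _ _ _ in D1 *; set D2w := detour _ _ _ _ _ _ in D2 *.
set F := flatten _ in uV.
(* Together the two detours use exactly the spokes of all old vertices and the two new loops. *)
have uD : uniq (walk_edges (last v w2) D2w ++ walk_edges (last v w1) D1w ++ F).
  rewrite catA; apply: etrans uV; apply/perm_uniq/perm_cat => //.
  rewrite spokes_cat; move: (spokes _ _ _) (spokes _ _ _) D1 D2 => S1 S2 D1 D2.
  apply/permP=> P; rewrite count_cat (permP D2) (permP D1) !count_cat.
  by rewrite /=; clear; lia.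
have uD1 : uniq (walk_edges (last v w1) D1w ++ F).
  by move: uD; rewrite cat_uniq => /and3P[].
have sys1 : walk_system k.+2 v [:: w1 ++ D1w, w2 & ws].
  apply: walk_system_extend; rewrite ?last_detour //.
  - by apply: all_detour => //; apply: ltnW.
  - by apply: walk_system_leq ws_sys; rewrite leqW.
rewrite walk_system_swap.
apply: walk_system_extend; rewrite ?last_detour //.
- by apply: all_detour => //; apply: ltnW.
- apply: etrans uD; apply/perm_uniq; rewrite perm_cat2l.
  have -> : flatten (map (walk_edges v) [:: w2, w1 ++ D1w & ws]) =
      walk_edges v w2 ++ (walk_edges v w1 ++ walk_edges (last v w1) D1w)
      ++ flatten (map (walk_edges v) ws) by rewrite -walk_edges_cat.
  rewrite /F; move: (walk_edges _ D1w) => E1; apply/permP=> P /=.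
  by rewrite !count_cat; clear; lia.
by rewrite walk_system_swap.
Qed.

(** The old vertices split into parts of sizes [2t] and [2s], each containing the end of the leg to
    be lengthened. Every old vertex contributes two spokes, and both new loops go to the first
    leg. *)
Lemma realizable_step k t s a b ls : ~~ odd k -> 0 < t -> t + s = k./2 ->
  realizable k [:: a, b & ls] ->
  realizable k.+2 [:: a + (4 * t + 2), b + 4 * s & ls].
Proof.
move=> k_even t_gt0 ts [v [ws [size_ws ws_sys]]].
case: ws size_ws ws_sys => [|w1 [|w2 ws]] //= [<- <- <-] ws_sys.
have [r r_perm] : exists r, perm_eq [:: last v w1, last v w2 & r] (iota 0 k).
  have /and4P[v_lt /= /and3P[w1_lt w2_lt _] /= /andP[+ _] _] := ws_sys.
  rewrite inE negb_or => /andP[a12 _].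
  have last_lt w : all (fun x => x < k) w -> last v w < k.
    by move=> w_lt; apply: (allP (_ : all (fun x => x < k) (v :: w)));
      [rewrite /= v_lt | rewrite mem_last].
  exists (rem (last v w2) (rem (last v w1) (iota 0 k))); rewrite perm_sym.
  apply: (perm_trans (perm_to_rem (_ : last v w1 \in _))).
    by rewrite mem_iota last_lt.
  rewrite perm_cons perm_to_rem // rem_filter ?iota_uniq //.
  by rewrite mem_filter /= eq_sym a12 mem_iota last_lt.
have size_r : size r = 2 * (t + s) - 2.
  by move/perm_size: r_perm; clear -k_even t_gt0 ts; rewrite /= size_iota; lia.
(* For [s = 0] a single detour takes all old vertices, the end of [w2] included. *)
have [s0|s_gt0] := posnP s.
  have r_even : ~~ odd (size r) by clear -size_r; lia.
  exists v, [:: w1 ++ detour k k.+1 true (last v w1) (last v w2) r, w2 & ws].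
  split; last exact: walk_system_detour.
  rewrite /= size_cat size_detour // size_r s0; clear -t_gt0.
  by congr [:: _, _ & _]; lia.
case: r => [|b1 r] in r_perm size_r *.
  by move: size_r t_gt0 s_gt0; clear; rewrite /=; lia.
(* The first part already has the end of [w1] and [b1], so [2 * t - 2] further vertices complete
   it. *)
have size_s1 : size (take (2 * t - 2) r) = 2 * t - 2.
  by rewrite size_takel //; move: size_r t_gt0 s_gt0; clear; rewrite /=; lia.
have size_s2 : size (drop (2 * t - 2) r) = 2 * s - 1.
  by rewrite size_drop; move: size_r t_gt0 s_gt0; clear; rewrite /=; lia.
move: (take _ r) (drop _ r) (cat_take_drop (2 * t - 2) r) size_s1 size_s2.
move=> s1 [|b2 s2] r_def size_s1 /= size_s2; first by clear -s_gt0 size_s2; lia.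
have s1_even : ~~ odd (size s1) by clear -size_s1; lia.
have s2_even : ~~ odd (size s2) by clear -size_s2 s_gt0; lia.
exists v; eexists; split; last first.
  apply: (walk_system_detour2 (b1 := b1) (b2 := b2)) s1_even s2_even _ ws_sys.
  apply: perm_trans r_perm; rewrite -r_def.
  by apply/permP=> P; rewrite /= !count_cat /=; clear; lia.
rewrite /= !size_cat !size_detour // size_s1; clear -t_gt0 s_gt0 size_s2.
by congr [:: _, _ & _]; lia.
Qed.

(* Two trails A and B with A_i = B_j cut each other into four legs.           *)
Definition crossing (A B : seq nat) (i j : nat) : nat * seq (seq nat) :=
  (nth 0 A i, [:: rev (take i A); drop i.+1 A; rev (take j B); drop j.+1 B]).

(* "if" rather than "&&", as vm_compute evaluates both arguments of andb.     *)
Definition crossing_of (k : nat) (T : seq (seq nat * seq nat)) (ls : seq nat) :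
    bool :=
  has (fun AB => has (fun i => has (fun j =>
      let: (v, ws) := crossing AB.1 AB.2 i j in
      if perm_eq (map size ws) ls then walk_system k v ws else false)
    (iota 0 (size AB.2))) (iota 0 (size AB.1))) T.

Lemma crossing_realizable k T ls : crossing_of k T ls -> realizable k ls.
Proof.
case/hasP=> -[A B] _ /= /hasP[i _ /hasP[j _]].
case: ifP => // ls_perm ws_sys.
by apply: realizable_perm ls_perm _; do 2 eexists; split; last exact: ws_sys.
Qed.

(* The two trails of each pair cover K_4^*; in crossings6 they cover K_6^*    *)
(* minus an edge. Any common vertex of a pair can be the centre.              *)
Definition crossings4 : seq (seq nat * seq nat) :=
  [:: ([:: 1; 1; 3; 2; 2], [:: 0; 0; 1; 2; 0; 3; 3]);
      ([:: 1; 0; 2; 2; 1; 1; 3; 0; 0], [:: 3; 3; 2]);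
      ([:: 2; 3; 1], [:: 3; 3; 0; 1; 1; 2; 2; 0; 0]);
      ([:: 2; 2; 1; 3; 0], [:: 3; 3; 2; 0; 0; 1; 1]);
      ([:: 0; 3; 1; 0; 0; 2], [:: 1; 1; 2; 2; 3; 3])].

Definition crossings6 : seq (seq nat * seq nat) :=
  [:: ([:: 0; 0; 4; 3; 2; 5; 1; 2],
       [:: 3; 3; 1; 0; 5; 5; 3; 0; 2; 2; 4; 4; 1; 1]);
      ([:: 1; 3; 0; 2; 2; 4; 1; 5; 2],
       [:: 3; 2; 1; 1; 0; 0; 4; 4; 3; 3; 5; 5; 0]);
      ([:: 2; 4; 1; 0; 2; 3; 3],
       [:: 1; 2; 2; 5; 3; 4; 4; 0; 5; 5; 1; 1; 3; 0; 0]);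
      ([:: 3; 0; 4; 1; 2; 3; 3; 5; 1; 1],
       [:: 0; 0; 1; 3; 4; 4; 2; 2; 0; 5; 5; 2]);
      ([:: 3; 0; 4; 4; 3; 5; 0; 1; 2; 5; 5; 1; 3; 3; 2; 2],
       [:: 0; 0; 2; 4; 1; 1]);
      ([:: 2; 3; 4; 2; 1; 5; 3],
       [:: 0; 5; 5; 2; 2; 0; 3; 3; 1; 1; 0; 0; 4; 4; 1]);
      ([:: 1; 5; 2; 1; 3; 2; 0; 4; 4; 3; 3],
       [:: 2; 2; 4; 1; 1; 0; 0; 5; 5; 3; 0]);
      ([:: 1; 5; 0; 4; 3; 1; 2; 2; 3],
       [:: 0; 2; 5; 5; 3; 3; 0; 0; 1; 1; 4; 4; 2]);
      ([:: 3; 1; 4; 2; 2],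
       [:: 0; 4; 4; 3; 0; 2; 3; 3; 5; 2; 1; 5; 5; 0; 0; 1; 1]);
      ([:: 3; 5; 1],
       [:: 2; 5; 5; 0; 2; 3; 0; 1; 4; 2; 2; 1; 1; 3; 3; 4; 4; 0; 0]);
      ([:: 1; 2; 4; 4; 3; 3; 0; 1; 5; 0; 2],
       [:: 0; 0; 4; 1; 1; 3; 5; 5; 2; 2; 3])].

(** * The cases [k = 4] and [k = 6] *)

Lemma realizable4 b c d : 0 < b <= c -> c <= d -> b + c + d = 9 ->
  realizable 4 [:: 1; b; c; d].
Proof.
move=> /andP[b_gt0 le_bc] le_cd bcd; apply: (@crossing_realizable _ crossings4).
(* As [0 < b <= c <= d] and the sum is 9, both [b] and [c] are below 5. *)
have : all (fun b => all (fun c =>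
    if [&& 0 < b, b <= c & c <= 9 - b - c] then
      crossing_of 4 crossings4 [:: 1; b; c; 9 - b - c]
    else true) (iota 0 5)) (iota 0 5).
  by vm_compute.
move/allP/(_ b); rewrite mem_iota => /(_ ltac:(lia))/allP/(_ c).
rewrite mem_iota => /(_ ltac:(lia)); rewrite ifT; last lia.
by have -> : 9 - b - c = d by lia.
Qed.

Lemma realizable6 a b c d : 0 < a <= b -> b <= c <= d -> a + b + c + d = 20 ->
  realizable 6 [:: a; b; c; d].
Proof.
move=> /andP[a_gt0 le_ab] /andP[le_bc le_cd] abcd.
apply: (@crossing_realizable _ crossings6).
(* Likewise [2 * c <= 20 - a - b <= 18] keeps [a], [b] and [c] below 10. *)
have : all (fun a => all (fun b => all (fun c =>
    if [&& 0 < a, a <= b, b <= c & c <= 20 - a - b - c] then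
      crossing_of 6 crossings6 [:: a; b; c; 20 - a - b - c]
    else true) (iota 0 10)) (iota 0 10)) (iota 0 10).
  by vm_compute.
move/allP/(_ a); rewrite mem_iota => /(_ ltac:(lia))/allP/(_ b).
rewrite mem_iota => /(_ ltac:(lia))/allP/(_ c).
rewrite mem_iota => /(_ ltac:(lia)); rewrite ifT; last lia.
by have -> : 20 - a - b - c = d by lia.
Qed.

(** * Maximal spiders for all even [k >= 6] *)

Lemma realizable_sorted k N :
    (forall a b c d, 0 < a <= b -> b <= c <= d -> a + b + c + d = N ->
      realizable k [:: a; b; c; d]) ->
  forall a b c d, [/\ 0 < a, 0 < b, 0 < c & 0 < d] -> a + b + c + d = N ->
    realizable k [:: a; b; c; d].
Proof.
move=> Hk a b c d [a0 b0 c0 d0] abcd.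
have ls_perm := permEl (perm_sort leq [:: a; b; c; d]).
have := sort_sorted leq_total [:: a; b; c; d].
have := perm_all (leq 1) ls_perm; have := perm_sumn ls_perm.
have := perm_size ls_perm; move: ls_perm.
case: (sort _ _) => [|a' [|b' [|c' [|d' [|]]]]] //= ls_perm _.
rewrite a0 b0 c0 d0 !addn0 !andbT => sum_eq /and4P[a0' _ _ _] /and3P[ab bc cd].
by apply: realizable_perm ls_perm _; apply: Hk; rewrite ?a0' ?bc //; lia.
Qed.

(** The two longest legs are shortened. They have at least half the total length, so both stay
    nonempty if [4 * t + 2] is taken as large as one of them permits. *)
Lemma step_lengths m a b c d : 2 < m -> 0 < a <= b -> b <= c <= d ->
    a + b + c + d = 2 * m.+1 ^ 2 + 2 ->
  exists t s, [/\ 0 < t, t + s = m &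
    (4 * t + 2 < d) && (4 * s < c) || (4 * t + 2 < c) && (4 * s < d)].
Proof.
move=> m_gt2 /andP[a_gt0 le_ab] /andP[le_bc le_cd]; rewrite -mulnn => abcd.
(* For [m > 3] this makes [c + d] exceed [4 * m + 6], which covers the loss from rounding
   [(d - 3) %/ 4]. *)
have : (m == 3) || (4 * m <= m * m) by nia.
have [d_m|d_m] := leqP (4 * m + 3) d; first by exists m, 0; split; lia.
case/predU1P=> [m3|m_gt3]; last first.
  by exists ((d - 3) %/ 4), (m - (d - 3) %/ 4); split; lia.
rewrite {}m3 in abcd d_m *.
have [c_gt|c_le] := ltnP (12 - (d - 3) %/ 4 * 4) c.
  by exists ((d - 3) %/ 4), (3 - (d - 3) %/ 4); split; lia.
(* For [m = 3] rounding can spoil the choice made from [d], as for lengths 8, 8, 8, 10; the roles of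
   [c] and [d] are then exchanged. *)
by exists ((c - 3) %/ 4), (3 - (c - 3) %/ 4); split; lia.
Qed.

Lemma realizable_maximal m a b c d : 2 < m ->
    [/\ 0 < a, 0 < b, 0 < c & 0 < d] -> a + b + c + d = 2 * m ^ 2 + 2 ->
  realizable m.*2 [:: a; b; c; d].
Proof.
elim: m a b c d => // m IH a b c d; rewrite ltnS leq_eqVlt.
case/predU1P=> [<-|m_gt2].
  exact: (realizable_sorted realizable6).
move: a b c d; apply: realizable_sorted => a b c d a_le_b le_bcd abcd.
have [t [s [t_gt0 ts]]] := step_lengths m_gt2 a_le_b le_bcd abcd.
have m_half : t + s = m.*2./2 by rewrite doubleK.
have m_even : ~~ odd m.*2 by rewrite odd_double.
case/orP=> /andP[d_gt c_gt].
  have r : realizable m.*2 [:: d - (4 * t + 2); c - 4 * s; a; b].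
    by apply: IH; [|split; lia | rewrite -!mulnn in abcd *; nia].
  have := realizable_step m_even t_gt0 m_half r.
  rewrite (subnK (ltnW d_gt)) (subnK (ltnW c_gt)).
  by apply: realizable_perm; apply/permP=> P /=; lia.
have r : realizable m.*2 [:: c - (4 * t + 2); d - 4 * s; a; b].
  by apply: IH; [|split; lia | rewrite -!mulnn in abcd *; nia].
have := realizable_step m_even t_gt0 m_half r.
rewrite (subnK (ltnW d_gt)) (subnK (ltnW c_gt)).
by apply: realizable_perm; apply/permP=> P /=; lia.
Qed.

(** * Edges of the spider, and embeddings from trails *)

Lemma set2_inj (T : finType) (a b c d : T) :
  [set a; b] = [set c; d] -> (a = c /\ b = d) \/ (a = d /\ b = c).
Proof.
move=> eq_ab.
have /set2P a_cd : a \in [set c; d] by rewrite -eq_ab set21.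
have /set2P b_cd : b \in [set c; d] by rewrite -eq_ab set22.
have /set2P c_ab : c \in [set a; b] by rewrite eq_ab set21.
have /set2P d_ab : d \in [set a; b] by rewrite eq_ab set22.
by case: a_cd b_cd c_ab d_ab => ac [] bd [] ca [] db;
  solve [left; split; congruence | right; split; congruence].
Qed.

Lemma uniq_flatten_nth (T : eqType) (x0 : T) ss i j i' j' :
    uniq (flatten ss) -> i < size ss -> i' < size ss ->
    j < size (nth [::] ss i) -> j' < size (nth [::] ss i') ->
    nth x0 (nth [::] ss i) j = nth x0 (nth [::] ss i') j' ->
  i = i' /\ j = j'.
Proof.
elim: ss i i' => //= s ss IH i i'; rewrite cat_uniq.
case/and3P=> us /hasPn s_ss uss.
have notin p q : p < size ss -> q < size (nth [::] ss p) ->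
    nth x0 (nth [::] ss p) q \notin s.
  move=> p_lt q_lt; apply: s_ss; apply/flattenP; exists (nth [::] ss p).
    exact: mem_nth.
  exact: mem_nth.
case: i i' => [|i] [|i'] //=; rewrite ?ltnS.
- by move=> _ _ j_lt j'_lt /eqP; rewrite nth_uniq // => /eqP.
- by move=> _ i'_lt j_lt /(notin _ _ i'_lt) + eq_nth; rewrite -eq_nth mem_nth.
- by move=> i_lt _ /(notin _ _ i_lt) + j_lt eq_nth; rewrite eq_nth mem_nth.
- by move=> i_lt i'_lt j_lt j'_lt /(IH _ _ uss i_lt i'_lt j_lt j'_lt)[-> ->].
Qed.

Section SpiderEdges.

Variables (m : nat) (l : m.-tuple nat).

(** The non-central vertices also index the edges: each one stands for the edge to its neighbour
    nearer the centre. *)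
Definition leg_index : finType := {i : 'I_m & 'I_(tnth l i)}.

(* The j-th vertex of leg i, counted from the centre; junk for tnth l i < j. *)
Definition spider_node (i : 'I_m) (j : nat) : spider_vertex l :=
  if j is j'.+1 then
    omap (Tagged (fun i => 'I_(tnth l i))) (insub j' : option 'I_(tnth l i))
  else None.

Definition spider_parent (x : leg_index) : spider_vertex l :=
  spider_node (tag x) (tagged x).

Definition spider_edge (x : leg_index) : {set spider_vertex l} :=
  [set spider_parent x; Some x].

Lemma spider_nodeS i (j : 'I_(tnth l i)) :
  spider_node i j.+1 = Some (Tagged (fun i => 'I_(tnth l i)) j).
Proof. by rewrite /= valK. Qed.

Lemma spider_parentS i j (lt_j : j.+1 < tnth l i) :
  spider_parent (Tagged (fun i => 'I_(tnth l i)) (Ordinal lt_j)) =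
    Some (Tagged (fun i => 'I_(tnth l i)) (Ordinal (ltnW lt_j))).
Proof. by rewrite -spider_nodeS. Qed.

Lemma spider_step_parent u v :
  spider_step u v = if v is Some x then u == spider_parent x else false.
Proof.
case: v u => [[i [[|j] lt_j]]|] [[i' j']|] //=; first by rewrite andbF.
  rewrite spider_parentS (inj_eq Some_inj) -tag_eqE /tag_eq /=.
  case: eqVneq => //= e; move: j'; rewrite e => j'.
  by rewrite tagged_asE -val_eqE /= eqSS eq_sym.
by rewrite spider_parentS.
Qed.

Lemma spider_edgesP (e : {set vertex (spider l)}) :
  reflect (exists x, e = spider_edge x) (e \in edges (spider l)).
Proof.
apply: (iffP imsetP) => [[[u v]]|[x ->]]; last first.
  by exists (spider_parent x, Some x); rewrite ?inE //= /spider_adj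
    spider_step_parent eqxx.
rewrite inE /= /spider_adj !spider_step_parent => /orP[].
  by case: v => // x /eqP-> ->; exists x.
by case: u => // x /eqP-> ->; exists x; rewrite /= setUC.
Qed.

Definition depth (u : spider_vertex l) : nat :=
  if u is Some x then (tagged x).+1 else 0.

Lemma depth_parent x : depth (spider_parent x) = tagged x.
Proof.
by case: x => i [[|j] lt_j] //; rewrite spider_parentS.
Qed.

Lemma spider_edge_inj : injective spider_edge.
Proof.
move=> x y /set2_inj[[_ [//]]|[xy yx]].
(* If each of [x] and [y] were the parent of the other, each depth would be one less than the
   other. *)
have := depth_parent x; have := depth_parent y; rewrite -yx xy /=; lia.
Qed.

End SpiderEdges.

Lemma edge_set_eq k (a b c d : 'I_k) :
  [set a; b] = [set c; d] -> edge a b = edge c d.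
Proof. by move=> /set2_inj[[-> ->]|[-> ->]] //; rewrite edgeC. Qed.

Lemma realizable_embeds k m (l : m.-tuple nat) ls : size ls = m ->
    (forall i, tnth l i <= nth 0 ls i) -> realizable k ls ->
  embeds (spider l) (looped_complete k).
Proof.
move=> size_ls le_ls [v [ws [size_ws /and4P[v_lt ws_lt _ uE]]]].
have ws_m : size ws = m by rewrite -size_ls -size_ws size_map.
have leg_size (i : 'I_m) : tnth l i <= size (nth [::] ws i).
  by rewrite -(nth_map _ 0) ?ws_m // size_ws.
pose fn (u : spider_vertex l) : nat :=
  if u is Some (existT i j) then nth v (nth [::] ws i) j else v.
have fn_lt u : fn u < k.
  case: u => [[i j]|] //=.
  have /allP w_lt : all (fun x => x < k) (nth [::] ws i).
    by apply: (allP ws_lt); rewrite mem_nth ?ws_m.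
  by apply: w_lt; rewrite mem_nth // (leq_trans _ (leg_size i)).
pose f (u : vertex (spider l)) : vertex (looped_complete k) :=
  Ordinal (fn_lt u).
exists f; split=> // _ _ /spider_edgesP[x ->] /spider_edgesP[y ->].
rewrite /spider_edge !imsetU1 !imset_set1 => /edge_set_eq /=.
(* Leg and position of [z] locate its image in the lists of trail edges, whose entries are all
   distinct. *)
have edgeE (z : leg_index l) : edge (fn (spider_parent z)) (fn (Some z)) =
    nth (0, 0) (nth [::] (map (walk_edges v) ws) (tag z)) (tagged z).
  case: z => i j /=; have j_lt := leq_trans (ltn_ord j) (leg_size i).
  rewrite (nth_map [::]) ?ws_m // /walk_edges (nth_pairmap v) //.
  case: j j_lt => [[|j] lt_j] j_lt //; by rewrite spider_parentS.
rewrite -/(fn (Some x)) -/(fn (Some y)) !edgeE.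
have len_lt (z : leg_index l) :
    tagged z < size (nth [::] (map (walk_edges v) ws) (tag z)).
  rewrite (nth_map [::]) ?ws_m // size_pairmap.
  exact: leq_trans (ltn_ord _) (leg_size _).
case/(uniq_flatten_nth uE (_ : tag x < _) (_ : tag y < _)) => //;
  rewrite ?size_map ?ws_m //.
case: x y => [i j] [i' j'] /= /val_inj ii'.
move: j'; rewrite -ii' => j' /val_inj.
by move->.
Qed.

(** * Counting edges by degrees *)

Section EdgeCount.

Variables (k : nat) (I : finType) (a b : I -> 'I_k).
Hypothesis ab_inj : injective (fun x => [set a x; b x]).

(** The exclusive or makes a loop at [w] contribute 0, so this is the degree without loops. *)
Definition degree (w : 'I_k) : nat := \sum_x ((a x == w) (+) (b x == w)).

Lemma degree_leq w : degree w <= k.-1.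
Proof.
pose A := [set x | (a x == w) (+) (b x == w)].
have -> : degree w = #|A|.
  by rewrite -sum1dep_card big_mkcond; apply: eq_bigr => x _; case: (_ (+) _).
pose other x := if a x == w then b x else a x.
have otherP x : x \in A -> [set a x; b x] = [set w; other x] /\ other x != w.
  rewrite inE /other; case: (eqVneq (a x) w) => [->|/= ab] //=.
  by move/eqP->; rewrite setUC.
rewrite -(card_in_imset (f := other)).
  have -> : k.-1 = #|[set~ w]| by rewrite cardsC1 card_ord.
  apply/subset_leq_card/subsetP=> _ /imsetP[x /otherP[_ xw] ->].
  by rewrite !inE.
move=> x y /otherP[ex _] /otherP[ey _] exy.
by apply: ab_inj; rewrite ex ey exy.
Qed.

(** Every non-loop edge is counted at its two ends, and there are at most [k] loops. *)
Lemma edges_leq_degrees : #|I|.*2 <= \sum_w degree w + k.*2.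
Proof.
pose L := [set x | a x == b x].
have L_le : #|L| <= k.
  rewrite -(card_in_imset (f := a)).
    by rewrite -[leqRHS](card_ord k) max_card.
  move=> x y; rewrite !inE => /eqP ax /eqP ay axy.
  by apply: ab_inj; rewrite -ax -ay axy.
have -> : \sum_w degree w = (#|~: L|).*2.
  rewrite exchange_big -muln2 -sum_nat_const [RHS]big_mkcond /=.
  apply: eq_bigr => x _; rewrite !inE.
  have [ab|ab] := eqVneq (a x) (b x).
    by rewrite big1 // => w _; rewrite ab addbb.
  rewrite (bigD1 (a x)) //= (bigD1 (b x)) /=; last by rewrite eq_sym.
  rewrite !eqxx (negbTE ab) eq_sym (negbTE ab) big1 // => w /andP[wa wb].
  by rewrite !(eq_sym _ w) (negbTE wa) (negbTE wb).
by rewrite -(cardsC L) doubleD addnC leq_add2l leq_double.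
Qed.

End EdgeCount.

(** Modulo 2 the sum telescopes: inner visits to [w] cancel. *)
Lemma odd_sum_path (T : eqType) (h : nat -> T) w n :
  odd (\sum_(j < n) ((h j == w) (+) (h j.+1 == w))) = (h 0 == w) (+) (h n == w).
Proof.
elim: n => [|n IH]; first by rewrite big_ord0 addbb.
by rewrite big_ord_recr oddD IH oddb addbA addbK.
Qed.

(** * Necessity of the three conditions *)

Section Necessity.

Variables (k : nat) (l : 4.-tuple nat).
Variable f : vertex (spider l) -> 'I_k.
Hypothesis f_inj : {in edges (spider l) &,
  injective (fun e : {set vertex (spider l)} => f @: e)}.

Let a (x : leg_index l) := f (spider_parent x).
Let b (x : leg_index l) := f (Some x).

Lemma spider_image_inj : injective (fun x => [set a x; b x]).
Proof.
move=> x y; have imE z : [set a z; b z] = f @: spider_edge z.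
  by rewrite /spider_edge imsetU1 imset_set1.
rewrite !imE => /f_inj eq_xy; apply: spider_edge_inj.
by apply: eq_xy; apply/spider_edgesP; [exists x | exists y].
Qed.

Lemma card_leg_index : #|leg_index l| = \sum_(i < 4) tnth l i.
Proof.
rewrite card_tagged sumnE big_map big_enum.
by apply: eq_bigr => i _; rewrite card_ord.
Qed.

(** When [w] is no leaf image, each leg contributes the same parity, [f None == w], and four equal
    parities cancel. *)
Lemma odd_degree w : (forall i, f (spider_node l i (tnth l i)) != w) ->
  ~~ odd (degree a b w).
Proof.
move=> w_leaf.
have -> : degree a b w = \sum_(i < 4) \sum_(j < tnth l i)
    ((a (Tagged _ j) == w) (+) (b (Tagged _ j) == w)).
  by rewrite sig_big_dep; apply: eq_bigr => -[].
have leg_odd i : odd (\sum_(j < tnth l i)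
    ((a (Tagged _ j) == w) (+) (b (Tagged _ j) == w))) = (f None == w).
  rewrite -[RHS]addbF -(negbTE (w_leaf i)).
  rewrite -(odd_sum_path (fun j => f (spider_node l i j))).
  by congr odd; apply: eq_bigr => j _; rewrite /a /b spider_nodeS.
by rewrite !big_ord_recl big_ord0 !oddD !leg_odd; case: (_ == w).
Qed.

Hypothesis k_even : ~~ odd k.

Lemma spider_size : 0 < k -> (\sum_(i < 4) tnth l i).*2 <= k ^ 2 + 4.
Proof.
move=> k_gt0; rewrite -card_leg_index.
apply: leq_trans (edges_leq_degrees spider_image_inj) _.
pose leaves := [set f (spider_node l i (tnth l i)) | i : 'I_4].
have deg_le w : degree a b w <= k - 2 + (w \in leaves).
  have := degree_leq spider_image_inj w.
  have [_|w_leaf] := boolP (w \in leaves); first lia.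
  (* An even degree bounded by the odd number [k - 1] is at most [k - 2]. *)
  have : ~~ odd (degree a b w).
    apply: odd_degree => i; apply: contraNneq w_leaf => <-.
    by apply/imsetP; exists i.
  lia.
have : \sum_w degree a b w <= k * (k - 2) + 4.
  apply: (@leq_trans (\sum_(w < k) (k - 2 + (w \in leaves)))).
    by apply: leq_sum => w _; apply: deg_le.
  rewrite big_split /= sum_nat_const card_ord leq_add2l.
  rewrite -big_mkcond /= sum1_card (leq_trans (leq_imset_card _ _)) //.
  by rewrite card_ord.
by rewrite -mulnn; nia.
Qed.

Lemma spider_k_gt2 : (forall i, 0 < tnth l i) -> 0 < k -> 2 < k.
Proof.
move=> l_gt0 k_gt0.
have size_ge : 4 <= #|leg_index l|.
  rewrite card_leg_index -{1}[4]card_ord -sum1_card.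
  by apply: leq_sum => i _; apply: l_gt0.
have deg_sum : \sum_w degree a b w <= k * k.-1.
  have <- : \sum_(w < k) k.-1 = k * k.-1 by rewrite sum_nat_const card_ord.
  by apply: leq_sum => w _; apply: degree_leq spider_image_inj w.
have := edges_leq_degrees spider_image_inj.
have [k_le|//] := leqP k 2.
have : k * k.-1 + k.*2 <= 6 by have [->|->] : k = 1 \/ k = 2 by lia.
by move: (\sum_w _) deg_sum size_ge => s; lia.
Qed.

Lemma spider_k4 : k = 4 -> ~ (forall i, 1 < tnth l i).
Proof.
move=> k4 l_gt1.
(* [x i] and [y i] are the first and second edges of leg [i]. *)
pose x i : leg_index l := Tagged _ (Ordinal (ltnW (l_gt1 i))).
pose y i : leg_index l := Tagged _ (Ordinal (l_gt1 i)).
have ax i : a (x i) = f None by [].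
have ay i : a (y i) = b (x i).
  by rewrite /a spider_parentS; congr (f (Some (Tagged _ _))); apply: val_inj.
have bx_inj : injective (b \o x).
  move=> i j /= eq_b; have : x i = x j.
    by apply: spider_image_inj; rewrite !ax eq_b.
  by move/(congr1 tag).
have bx_onto w : exists i, b (x i) = w.
  have : w \in codom (b \o x) by rewrite inj_card_onto // !card_ord k4.
  by case/codomP=> i ->; exists i.
(* Leg [i] starts with the loop at the centre, so its second edge leaves the centre again and must
   repeat some first edge [x j]. *)
have [i i_loop] := bx_onto (f None).
have [j jE] := bx_onto (b (y i)).
have : y i = x j by apply: spider_image_inj; rewrite ax ay i_loop jE.
by move/(congr1 (fun z : leg_index l => nat_of_ord (tagged z))).
Qed.

End Necessity.

Theorem theorem3p3 (k l1 l2 l3 l4 n : nat)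
    (k_gt0 : 0 < k) (k_even : ~~ odd k)
    (l1_ge1 : 1 <= l1) (l12 : l1 <= l2) (l23 : l2 <= l3) (l34 : l3 <= l4)
    (n_def : n = l1 + l2 + l3 + l4) :
  embeds (spider [tuple l1; l2; l3; l4]) (looped_complete k) <->
  [/\ 4 <= k, n <= (k ^ 2 + 4) %/ 2 & (k, l1) <> (4, 2)].
Proof.
set l := [tuple l1; l2; l3; l4].
have l_min i : l1 <= tnth l i.
  by rewrite (tnth_nth 0); case: i => -[|[|[|[|i]]]] //= _; lia.
split=> [[f [_ f_inj]]|[k_ge4 n_le k_l1]].
  split.
  - suff : 2 < k by lia.
    by apply: (spider_k_gt2 f_inj) => // i; apply: leq_trans (l_min i).
  - rewrite leq_divRL // muln2.
    apply: leq_trans (spider_size f_inj k_even k_gt0).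
    by rewrite !big_ord_recl big_ord0 !(tnth_nth 0) /= n_def; lia.
  - case=> k4 l1_2; apply: (spider_k4 f_inj k4) => i.
    by apply: leq_trans (l_min i); rewrite l1_2.
have [m km] : exists m, k = m.*2 by exists k./2; rewrite even_halfK.
rewrite leq_divRL // km in n_le.
have {}n_le : n <= 2 * m ^ 2 + 2 by rewrite -!mulnn in n_le *; lia.
pose d := 2 * m ^ 2 + 2 - (l1 + l2 + l3).
suff : realizable k [:: l1; l2; l3; d].
  apply: realizable_embeds => // i; rewrite (tnth_nth 0).
  by case: i => -[|[|[|[|i]]]] //= _; rewrite /d; lia.
have [m_gt2|m_le2] := ltnP 2 m.
  by rewrite km; apply: realizable_maximal; rewrite // /d; [split; lia | lia].
have m2 : m = 2 by lia.
(* For [k = 4], [4 * l1 <= n <= 10] leaves only 1 and the excluded value 2. *)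
have l1_1 : l1 = 1.
  have : l1 <> 2 by move=> l1_2; apply: k_l1; rewrite km m2 l1_2.
  by rewrite m2 in n_le; lia.
rewrite km l1_1 m2; apply: realizable4; rewrite /d m2 in n_le *; lia.
Qed.
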